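(* Let $T$, $T^1$ and $S^1$ be the semigroups defined in the context, so that $T\leq T^1\leq S^1$ with $T^1\setminus T$ and $S^1\setminus T^1$ finite. Then the semigroups $S^1$ and $T$ are hopfian, while the semigroup $T^1$ is not hopfian. Hence hopficity is preserved neither by finite Rees index extensions nor by finite Rees index subsemigroups; that is, it is not true that whenever $V$ is a subsemigroup of a semigroup $U$ with $U\setminus V$ finite and $V$ is hopfian then $U$ is hopfian, and it is not true that whenever $V$ is a subsemigroup of a semigroup $U$ with $U\setminus V$ finite and $U$ is hopfian then $V$ is hopfian.
   Context: A semigroup is hopfian if every surjective (semigroup) endomorphism of it is an automorphism. The Rees index of a subsemigroup $V$ of a semigroup $U$ is $|U\setminus V|$. Construction. For each $i\in\mathbb{N}=\{1,2,\dots\}$ let $T_i$ be the monogenic semigroup given by the presentation $\langle b_i \mid b_i^2=b_i^4\rangle$; the $T_i$ are taken pairwise disjoint. Let $T=\bigcup_{i\in\mathbb{N}}T_i$, with multiplication extending that of each $T_i$ by $xy=yx=y$ for all $x\in T_i$, $y\in T_j$ with $i<j$. This is a semigroup. Let $F$ be the monogenic semigroup given by the presentation $\langle a\mid a^5=a^2\rangle$, disjoint from $T$. Let $S=T\cup F$, with multiplication extending those of $T$ and $F$ by $xy=yx=y$ for all $x\in F$, $y\in T$. This is a semigroup. Let $S^1=S\cup\{1\}$ be $S$ with a new identity element $1$ adjoined, and let $T^1=T\cup\{1\}\subseteq S^1$. *)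

(* Defs.v *)
From HB Require Import structures.
From mathcomp Require Import all_boot.
From mathcomp Require Import zify.
From mathcomp Require Import boolp classical_sets cardinality.

Set Implicit Arguments.
Unset Strict Implicit.
Unset Printing Implicit Defensive.

Local Open Scope group_scope.
Local Open Scope quotient_scope.

(* The endomorphisms are those of semigroups: if [G] has an identity, they    *)
(* need not preserve it.                                                      *)
Definition hopfian (G : semigroupType) : Prop :=
  forall f : {multiplicative G -> G},
    (forall y : G, exists x : G, f x = y) -> bijective f.

Section Subsemigroup.
Variables (U : semigroupType) (V : mulgClosed U).

Record subsemigroup : Type :=
  Subsemigroup { subsemigroup_val : U; _ : subsemigroup_val \in V }.

HB.instance Definition _ := [isSub for subsemigroup_val].
HB.instance Definition _ := [Choice of subsemigroup by <:].

Fact subsemigroup_closed : mulg_closed (fun x : U => x \in V).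
Proof. exact: gpredM. Qed.

HB.instance Definition _ :=
  SubChoice_isSubSemigroup.Build U (fun x => x \in V) subsemigroup
    subsemigroup_closed.

Definition finite_Rees_index : Prop :=
  finite_set [set x : U | x \notin V]%classic.

End Subsemigroup.

Section FreeSemigroup.
Variable X : choiceType.

Definition free_semigroup : Type := {s : seq X | s != [::]}.

HB.instance Definition _ := Choice.on free_semigroup.

Implicit Types u v w : free_semigroup.

Fact free_mul_subproof u v : val u ++ val v != [::].
Proof. by case: u => [[|x s] //]. Qed.

Definition free_mul u v : free_semigroup :=
  exist _ (val u ++ val v) (free_mul_subproof u v).

Fact free_mulA : associative free_mul.
Proof. by move=> u v w; apply: val_inj; rewrite /= catA. Qed.

HB.instance Definition _ := isSemigroup.Build free_semigroup free_mulA.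

Definition letter (x : X) : free_semigroup := exist _ [:: x] isT.

End FreeSemigroup.

Section Presentation.
Variables (X : choiceType) (R : free_semigroup X -> free_semigroup X -> Prop).

Inductive presentation_cong : free_semigroup X -> free_semigroup X -> Prop :=
| Cong_rel u v : R u v -> presentation_cong u v
| Cong_refl u : presentation_cong u u
| Cong_sym u v : presentation_cong u v -> presentation_cong v u
| Cong_trans u v w :
    presentation_cong u v -> presentation_cong v w -> presentation_cong u w
| Cong_mul u u' v v' :
    presentation_cong u u' -> presentation_cong v v' ->
    presentation_cong (u * v) (u' * v').

Definition presentation_eqv : rel (free_semigroup X) :=
  fun u v => `[< presentation_cong u v >].

Fact presentation_eqv_refl : reflexive presentation_eqv.
Proof. by move=> u; apply/asboolP/Cong_refl. Qed.

Fact presentation_eqv_sym : symmetric presentation_eqv.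
Proof. by move=> u v; apply/asboolP/asboolP; apply: Cong_sym. Qed.

Fact presentation_eqv_trans : transitive presentation_eqv.
Proof.
by move=> v u w /asboolP uv /asboolP vw; apply/asboolP/(Cong_trans uv vw).
Qed.

Canonical presentation_equiv :=
  EquivRel presentation_eqv presentation_eqv_refl presentation_eqv_sym
    presentation_eqv_trans.

Definition presented : Type := {eq_quot presentation_equiv}.

HB.instance Definition _ := Choice.on presented.
HB.instance Definition _ := EqQuotient.on presented.

Definition presented_mul (x y : presented) : presented :=
  \pi_presented (repr x * repr y).

Fact piP_presented u v :
  presentation_cong u v <-> \pi_presented u = \pi_presented v.
Proof. by split=> [uv|/eqmodP/asboolP //]; apply/eqmodP/asboolP. Qed.

Fact presented_mul_pi u v :
  presented_mul (\pi u) (\pi v) = \pi_presented (u * v).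
Proof. by apply/piP_presented/Cong_mul; apply/piP_presented; rewrite reprK. Qed.

Fact presented_mulA : associative presented_mul.
Proof.
move=> x y z; rewrite -(reprK x) -(reprK y) -(reprK z).
by rewrite !presented_mul_pi mulgA.
Qed.

HB.instance Definition _ := isSemigroup.Build presented presented_mulA.

End Presentation.

(* [x ^ n] for [n > 0]; the value at [n = 0] is irrelevant. *)
Definition sgexp (G : semigroupType) (x : G) (n : nat) : G := iterop n mul x x.

(* <a | a ^ m = a ^ n> *)
Definition monogenic (m n : nat) : Type :=
  presented (fun u v : free_semigroup unit =>
    u = sgexp (letter tt) m /\ v = sgexp (letter tt) n).

HB.instance Definition _ m n := Semigroup.on (monogenic m n).
HB.instance Definition _ m n := EqQuotient.on (monogenic m n).

(* Disjoint copies [M_i = {i} * M], with [xy = yx = y] for [x] in [M_i], [y]  *)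
(* in [M_j] and [i < j].                                                      *)
Section Chain.
Variable M : semigroupType.

Definition semigroup_chain : Type := (nat * M)%type.

HB.instance Definition _ := Choice.copy semigroup_chain (nat * M)%type.

Definition chain_mul (x y : semigroup_chain) : semigroup_chain :=
  if x.1 < y.1 then y else if y.1 < x.1 then x else (x.1, x.2 * y.2).

Fact chain_mulA : associative chain_mul.
Proof.
move=> [i x] [j y] [k z]; rewrite /chain_mul /=.
by case: (ltngtP i j) => [ij|ji|ij] /=; case: (ltngtP j k) => [jk|kj|jk] /=;
  case: (ltngtP i k) => [ik|ki|ik] //=; (try by lia); subst;
  rewrite ?ltnn ?mulgA //; case: ltngtP => //; lia.
Qed.

HB.instance Definition _ := isSemigroup.Build semigroup_chain chain_mulA.

End Chain.

(* Disjoint union of [F] and [T], with [xy = yx = y] for [x] in [F], [y] in   *)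
(* [T].                                                                       *)
Section IdUnion.
Variables F T : semigroupType.

Definition id_union : Type := (F + T)%type.

HB.instance Definition _ := Choice.copy id_union (F + T)%type.

Definition id_union_mul (x y : id_union) : id_union :=
  match x, y with
  | inl f, inl g => inl (f * g)
  | inl _, inr t => inr t
  | inr t, inl _ => inr t
  | inr s, inr t => inr (s * t)
  end.

Fact id_union_mulA : associative id_union_mul.
Proof. by move=> [f|s] [g|t] [h|u] //=; rewrite mulgA. Qed.

HB.instance Definition _ := isSemigroup.Build id_union id_union_mulA.

End IdUnion.

(* [S ^ 1]: a new identity [None] is adjoined even if [S] has one. *)
Section Adjoin1.
Variable S : semigroupType.

Definition adjoin1 : Type := option S.

HB.instance Definition _ := Choice.copy adjoin1 (option S).

Definition adjoin1_mul (x y : adjoin1) : adjoin1 :=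
  match x, y with
  | None, _ => y
  | _, None => x
  | Some s, Some t => Some (s * t)
  end.

Fact adjoin1_mulA : associative adjoin1_mul.
Proof. by move=> [s|] [t|] [u|] //=; rewrite mulgA. Qed.

Fact adjoin1_mul1 : left_id None adjoin1_mul.
Proof. by []. Qed.

Fact adjoin1_mulr1 : right_id None adjoin1_mul.
Proof. by case. Qed.

HB.instance Definition _ :=
  isMonoid.Build adjoin1 adjoin1_mulA adjoin1_mul1 adjoin1_mulr1.

End Adjoin1.

(* The index [i : nat] of the chain stands for the positive integer [i.+1]. *)
Definition Tsg : semigroupType := semigroup_chain (monogenic 2 4).
Definition Fsg : semigroupType := monogenic 5 2.
Definition Ssg : semigroupType := id_union Fsg Tsg.
Definition S1 : monoidType := adjoin1 Ssg.

Definition in_T : pred S1 := fun x => if x is Some (inr _) then true else false.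
Definition in_T1 : pred S1 := fun x => (x == 1) || in_T x.

Fact in_T_closed : mulg_closed in_T.
Proof. by move=> [[f|s]|] [[g|t]|]. Qed.

HB.instance Definition _ := isMulClosed.Build S1 in_T in_T_closed.

Fact in_T1_closed : mulg_closed in_T1.
Proof. by move=> [[f|s]|] [[g|t]|]. Qed.

HB.instance Definition _ := isMulClosed.Build S1 in_T1 in_T1_closed.

(* The copies of [Tsg] and of [Tsg] with the identity of [S1], inside [S1]. *)
Definition T : mulgClosed S1 := MulClosed.clone S1 in_T _.
Definition T1 : mulgClosed S1 := MulClosed.clone S1 in_T1 _.

(* Main.v *)
(** A surjective endomorphism of [T] permutes the components [T_i]: it maps
    each into a single one, is weakly monotone on indices, and must hit every
    [b_j], which is irreducible in [T_j] and so is the image of some [b_i].  No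
    other component maps to [T_j], because [b_j] fixes no element of [T_j]
    under multiplication and is not of the form [y b_j].  A monotone bijection
    of the indices is the identity, hence so is the endomorphism.

    In [S^1] the generator [a] can only come from itself: each [x] in [T]
    satisfies [x^2 = x^4] whereas [a^2 <> a^4].  Hence [F] and [1] are fixed
    pointwise; since [a] acts as an identity on [T] but fixes no element of
    [F] or [1], [T] is mapped into, and so onto, itself.

    [T^1] lacks the rigid layer [F]: shifting [T_(i+1)] onto [T_i] and
    collapsing the top component onto [1] is surjective and not injective. *)

Require Import Defs.
From HB Require Import structures.
From mathcomp Require Import all_boot.
From mathcomp Require Import zify.
From mathcomp Require Import boolp classical_sets cardinality.

Set Implicit Arguments.
Unset Strict Implicit.
Unset Printing Implicit Defensive.

Local Open Scope group_scope.
Local Open Scope quotient_scope.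

(** * Powers in a semigroup *)

Lemma sgexpSS (G : semigroupType) (x : G) n :
  sgexp x n.+2 = x * sgexp x n.+1.
Proof. by []. Qed.

(** Exponents are successors because [sgexp x 0] is [x], so the law can fail at [0]. *)
Lemma sgexpD (G : semigroupType) (x : G) m n :
  sgexp x (m.+1 + n.+1) = sgexp x m.+1 * sgexp x n.+1.
Proof.
elim: m => [|m IHm]; first by rewrite add1n sgexpSS.
by rewrite sgexpSS -mulgA -IHm !addSn.
Qed.

Lemma sgexpM (G : semigroupType) (x : G) m n :
  sgexp x (m.+1 * n.+1) = sgexp (sgexp x m.+1) n.+1.
Proof.
elim: n => [|n IHn]; first by rewrite muln1.
by rewrite sgexpSS -IHn -sgexpD mulnS.
Qed.

Lemma morph_sgexp (G H : semigroupType) (f : G -> H) (x : G) n :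
  {morph f : x y / x * y} -> f (sgexp x n) = sgexp (f x) n.
Proof.
move=> fM; case: n => [//|n].
by elim: n => [//|n IHn]; rewrite !sgexpSS fM IHn.
Qed.

(** * Monogenic semigroups and invariants of word length *)

Section Monogenic.
Variables m n : nat.

Definition gen : monogenic m n := \pi_(monogenic m n) (letter tt).

Lemma monogenic_piM (u v : free_semigroup unit) :
  \pi_(monogenic m n) (u * v) = \pi_(monogenic m n) u * \pi_(monogenic m n) v.
Proof. exact: esym (presented_mul_pi _ u v). Qed.

Lemma size_sgexp_letter k : size (val (sgexp (letter tt) k.+1)) = k.+1.
Proof. by elim: k => [//|k IHk]; rewrite sgexpSS /= IHk. Qed.

Lemma free_unit_sgexp (u : free_semigroup unit) :
  exists k, u = sgexp (letter tt) k.+1.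
Proof.
case: u => [[//|x s] us]; exists (size s); apply: val_inj.
rewrite [LHS]/=; elim: s x {us} => [|y s IHs] x; first by case: x.
by rewrite sgexpSS [RHS]/= -(IHs y); case: x.
Qed.

Lemma monogenicP (x : monogenic m n) : exists k, x = sgexp gen k.+1.
Proof.
have [k rxE] := free_unit_sgexp (repr x).
by exists k; rewrite -[LHS]reprK rxE (morph_sgexp _ _ monogenic_piM).
Qed.

Lemma monogenic_rel : sgexp gen m = sgexp gen n.
Proof.
rewrite -!(morph_sgexp _ _ monogenic_piM).
by apply/piP_presented/Cong_rel.
Qed.

(** Word length modulo [d] is invariant under the congruence, since the defining relation preserves
    it. *)
Lemma monogenic_mod d i j :
    (0 < m)%N -> (0 < n)%N -> (m = n %[mod d])%N ->
  sgexp gen i.+1 = sgexp gen j.+1 -> (i.+1 = j.+1 %[mod d])%N.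
Proof.
move=> m_gt0 n_gt0 mn; rewrite -!(morph_sgexp _ _ monogenic_piM).
move/piP_presented => uv; rewrite -(size_sgexp_letter i) -(size_sgexp_letter j).
elim: uv => {i j} [u v [-> ->]|//|//|u v w _ -> //|u u' v v' _ uu' _ vv'].
  by rewrite -(prednK m_gt0) -(prednK n_gt0) !size_sgexp_letter !prednK.
by rewrite !size_cat -modnDm uu' vv' modnDm.
Qed.

(** Both sides of the defining relation have length at least two, so only the one-letter word
    represents [gen]. *)
Lemma gen_indecomposable (x y : monogenic m n) :
  (1 < m)%N -> (1 < n)%N -> x * y <> gen.
Proof.
move=> m_gt1 n_gt1; rewrite -(reprK x) -(reprK y) -monogenic_piM.
move/piP_presented => uv.
suff: (size (val (repr x * repr y)) == 1%N) = (size (val (letter tt)) == 1%N).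
  case: (repr x) (repr y) => [[//|? s] ?] [[//|? t] ?] /=.
  by rewrite size_cat addnS.
elim: uv => [u v [-> ->]|//|//|u v w _ -> //|u u' v v' _ _ _ _].
  by case: m n m_gt1 n_gt1 => [//|m'] [//|n']; rewrite !size_sgexp_letter; lia.
case: u u' v v' => [[//|? ?] ?] [[//|? ?] ?] [[//|? ?] ?] [[//|? ?] ?].
by rewrite /= !size_cat /= !addnS.
Qed.

(** Multiplying by [gen] adds one to the exponent and so changes its residue modulo [d]. *)
Lemma gen_mul_neq d (x : monogenic m n) :
    (1 < d)%N -> (0 < m)%N -> (0 < n)%N -> (m = n %[mod d])%N ->
  gen * x <> x.
Proof.
move=> d_gt1 m_gt0 n_gt0 mn; have [k ->] := monogenicP x.
rewrite -sgexpSS => /(monogenic_mod m_gt0 n_gt0 mn)/eqP.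
rewrite -(addn1 k.+1) -[in X in _ == X](addn0 k.+1) eqn_modDl mod0n.
by rewrite modn_small.
Qed.

End Monogenic.

(** * Surjective endomorphisms of a chain *)

Section Chain.
Variables (M : semigroupType) (b : M).
Implicit Types (i j : nat) (f : semigroup_chain M -> semigroup_chain M).

Lemma chain_lt i j (x y : M) :
  (i < j)%N -> ((i, x) : semigroup_chain M) * (j, y) = (j, y).
Proof. by move=> ij; rewrite /mul /= /chain_mul /= ij. Qed.

Lemma chain_gt i j (x y : M) :
  (j < i)%N -> ((i, x) : semigroup_chain M) * (j, y) = (i, x).
Proof. by move=> ji; rewrite /mul /= /chain_mul /= ji ltnNge (ltnW ji). Qed.

Lemma chain_eq i (x y : M) :
  ((i, x) : semigroup_chain M) * (i, y) = (i, x * y).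
Proof. by rewrite /mul /= /chain_mul /= ltnn. Qed.

Lemma chain_inM i : {morph (fun x => (i, x) : semigroup_chain M) : x y / x * y}.
Proof. by move=> x y; rewrite chain_eq. Qed.

Hypothesis genb : forall x : M, exists k, x = sgexp b k.+1.
Hypothesis b_indecomposable : forall x y : M, x * y <> b.
Hypothesis b_mul_neq : forall x : M, b * x <> x.

Lemma chain_surj_endo f :
    {morph f : x y / x * y} -> (forall y, exists x, f x = y) ->
  f =1 id.
Proof.
move=> fM fsurj.
have f_exp i k : f (i, sgexp b k) = sgexp (f (i, b)) k.
  by rewrite (morph_sgexp _ _ (chain_inM i)) (morph_sgexp _ _ fM).
(* A preimage of [(j, b)] is a power of some [(i, b)]; an exponent above one would decompose [b]. *)
have f_gen j : exists i, f (i, b) = (j, b).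
  have [[i x]] := fsurj (j, b); have [k ->] := genb x.
  rewrite f_exp; case: k => [|k]; first by exists i.
  case: (f (i, b)) => l y; rewrite -(morph_sgexp _ _ (chain_inM l)) sgexpSS.
  by case=> _ /b_indecomposable.
(* Since [(i, b)] fixes [(j, b)], reversed indices would make the product of the images the first
   image instead of the second. *)
have f_mono i j : (i < j)%N -> ((f (i, b)).1 <= (f (j, b)).1)%N.
  move=> ij; have := fM (i, b) (j, b); rewrite (chain_lt _ _ ij).
  case: (f (i, b)) (f (j, b)) => k x [l y] /=.
  by case: (leqP k l) => // lk; rewrite (chain_gt _ _ lk) => -[ll _]; lia.
(* With [f (i', b) = (j, y)], the case [i < i'] gives [b * y = y] and the case [i' < i] gives
   [y * b = b]. *)
have f_fiber i i' j : f (i, b) = (j, b) -> (f (i', b)).1 = j -> i' = i.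
  move=> fi; case fi': (f (i', b)) => [l y] /= lj; subst l.
  case: (ltngtP i i') => // ii'.
    have := fM (i, b) (i', b); rewrite (chain_lt _ _ ii') fi fi' chain_eq.
    by case=> /esym/b_mul_neq.
  have := fM (i', b) (i, b); rewrite (chain_lt _ _ ii') fi fi' chain_eq.
  by case=> /esym/b_indecomposable.
have f_b j : f (j, b) = (j, b).
  (* Smaller generators are already fixed, so [i < j] is impossible; if [j < i], then [(j, b)] lands
     at an index at most [j], where [f_fiber] forbids a second generator. *)
  elim/ltn_ind: j => j IHj; have [i fi] := f_gen j.
  case: (ltngtP i j) => [ij|ji|ij]; last by rewrite -{1}ij.
  - by move: (IHj _ ij); rewrite fi => -[jE]; lia.
  have := f_mono _ _ ji; rewrite fi /= leq_eqVlt => /orP[/eqP fj|lt_fj].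
    by have := f_fiber _ _ _ fi fj; lia.
  by have := f_fiber _ _ _ (IHj _ lt_fj) erefl; lia.
move=> [i x]; have [k ->] := genb x.
by rewrite f_exp f_b -(morph_sgexp _ _ (chain_inM i)).
Qed.

End Chain.

(** * Transport of hopficity, and hopficity of the abstract copy of [T] *)

Lemma eq_id_bij (A : Type) (f : A -> A) : f =1 id -> bijective f.
Proof. by move=> fE; exists id => x; rewrite !fE. Qed.

(** Conjugation by the isomorphism [h] of [G] onto [V] turns endomorphisms of [V] into endomorphisms
    of [G]. This serves [T] both inside [S1] and inside [T1]. *)
Lemma hopfian_range (G U : semigroupType) (V : mulgClosed U) (h : G -> U) :
    injective h -> {morph h : x y / x * y} ->
    (forall u, u \in V <-> exists x, h x = u) ->
  hopfian G -> hopfian (subsemigroup V).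
Proof.
move=> h_inj hM hV hopG f fsurj.
have inV x : h x \in V by apply/hV; exists x.
pose p x : subsemigroup V := Subsemigroup (inV x).
have pM : {morph p : x y / x * y}.
  by move=> x y; apply: val_inj; rewrite gmulfM /= hM.
have p_surj (u : subsemigroup V) : exists x, p x = u.
  by have /hV[x hx] := valP u; exists x; apply: val_inj.
have [q pK] := choice p_surj.
have qK : cancel p q by move=> x; apply: h_inj; exact: (congr1 val (pK (p x))).
pose g x := q (f (p x)).
have gM : {morph g : x y / x * y}.
  move=> x y; rewrite /g pM gmulfM; apply: (can_inj qK).
  by rewrite pM !pK.
pose gB := isMultiplicative.Build G G g gM.
pose gm : {multiplicative G -> G} := HB.pack g gB.
have [|g' gK g'K] := hopG gm.
  move=> y; have [u fu] := fsurj (p y).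
  by exists (q u); rewrite /= /g pK fu qK.
exists (p \o g' \o q) => u /=.
  by rewrite -{1}(pK u) [g' _]gK pK.
by rewrite -[LHS]pK [q _]g'K pK.
Qed.

Lemma T_surj_endo (f : Tsg -> Tsg) :
  {morph f : x y / x * y} -> (forall y, exists x, f x = y) -> f =1 id.
Proof.
apply: (chain_surj_endo (@monogenicP 2 4)).
  by move=> x y; apply: gen_indecomposable.
by move=> x; apply: (@gen_mul_neq _ _ 2).
Qed.

Lemma hopfian_Tsg : hopfian Tsg.
Proof. by move=> f fsurj; apply/eq_id_bij/T_surj_endo => //; exact: gmulfM. Qed.

(** * Hopficity of [S1] *)

Definition S1_F (x : Fsg) : S1 := Some (inl x).
Definition S1_T (x : Tsg) : S1 := Some (inr x).

Lemma S1_FM : {morph S1_F : x y / x * y}. Proof. by []. Qed.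

Lemma S1_TM : {morph S1_T : x y / x * y}. Proof. by []. Qed.

Lemma S1_FT x y : S1_F x * S1_T y = S1_T y. Proof. by []. Qed.

Lemma T_sqr (x : Tsg) : sgexp x 2 = sgexp x 4.
Proof.
case: x => i x; have [k ->] := monogenicP x.
rewrite -!(morph_sgexp _ _ (chain_inM i)) -!sgexpM ![(k.+1 * _)%N]mulnC !sgexpM.
by rewrite monogenic_rel.
Qed.

Lemma hopfian_S1 : hopfian S1.
Proof.
move=> f fsurj; have fM : {morph f : x y / x * y} by exact: gmulfM.
pose a : Fsg := gen 5 2.
(* A semigroup endomorphism need not fix [1], but if [f x = 1] then [1 = f (x * 1) = 1 * f 1]. *)
have f1 : f 1 = 1.
  by have [x fx] := fsurj 1; have := fM x 1; rewrite mulg1 fx mul1g.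
have fa : f (S1_F a) = S1_F a.
  have [[[x|x]|] fx] := fsurj (S1_F a); last by move: fx; rewrite [f _]f1.
    move: fx; have [k ->] := monogenicP x.
    rewrite -[Some _]/(S1_F _) (morph_sgexp _ _ S1_FM) (morph_sgexp _ _ fM).
    case: k => [//|k]; case: (f _) => [[y|y]|]; last 2 first.
    - by rewrite -[Some _]/(S1_T _) -(morph_sgexp _ _ S1_TM).
    - by elim: k => [//|k IHk]; rewrite sgexpSS mul1g.
    rewrite -[Some _]/(S1_F _) -(morph_sgexp _ _ S1_FM) sgexpSS.
    by case=> /gen_indecomposable; case.
  (* A preimage in [T] would force [a ^ 2 = a ^ 4], but exponents in [F] are determined modulo
     [3 = 5 - 2]. *)
  have : f (S1_T (sgexp x 2)) = f (S1_T (sgexp x 4)) by rewrite T_sqr.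
  rewrite !(morph_sgexp _ _ S1_TM) !(morph_sgexp _ _ fM) [f _]fx.
  rewrite -!(morph_sgexp _ _ S1_FM).
  by case=> /(@monogenic_mod _ _ 3 1 3) => /(_ isT isT erefl).
have fF x : f (S1_F x) = S1_F x.
  have [k ->] := monogenicP x.
  by rewrite (morph_sgexp _ _ S1_FM) (morph_sgexp _ _ fM) fa.
have fT x : exists y, f (S1_T x) = S1_T y.
  have := fM (S1_F a) (S1_T x); rewrite S1_FT fa.
  case: (f _) => [[y|y]|//]; last by exists y.
  by case=> /esym/(@gen_mul_neq _ _ 3); case.
have [g gE] := choice fT.
have g_id : g =1 id.
  apply: T_surj_endo => [x y|y].
    have := fM (S1_T x) (S1_T y); rewrite -S1_TM !gE.
    by case.
  have [[[x|x]|] fx] := fsurj (S1_T y).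
  - by move: fx; rewrite [f _]fF.
  - by exists x; move: fx; rewrite [f _]gE; case.
  - by move: fx; rewrite [f _]f1.
apply: eq_id_bij => -[[x|x]|]; [exact: fF | | exact: f1].
by rewrite [LHS]gE g_id.
Qed.

(** * Finite Rees indices, hopficity of [T] and its failure for [T1] *)

Lemma T_sub_T1 : {subset T <= T1}.
Proof. by move=> x xT; apply/orP; right. Qed.

Lemma in_TP (u : S1) : u \in T <-> exists x, S1_T x = u.
Proof. by split=> [|[x <- //]]; case: u => [[x|x]|] // _; exists x. Qed.

Lemma S1_T_inj : injective S1_T.
Proof. by move=> x y []. Qed.

Lemma hopfian_T : hopfian (subsemigroup T).
Proof. exact: hopfian_range S1_T_inj S1_TM in_TP hopfian_Tsg. Qed.

Lemma finite_F : finite_set [set: Fsg]%classic.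
Proof.
pose p k := sgexp (gen 5 2) k.+1.
apply: (sub_finite_set _ (finite_image p (finite_II 5))).
move=> x _; have [k ->] := monogenicP x.
elim/ltn_ind: k => k IHk; have [k5|k5] := ltnP k 5; first by exists k.
have [|j j5 jE] := IHk (k - 3)%N; first by lia.
exists j => //; rewrite jE.
(* The factor [a ^ 5] is replaced by [a ^ 2], leaving a cofactor of positive exponent as [sgexpD]
   requires; hence the bound [5], although [F] has four elements. *)
have -> : k = (4 + (k - 5).+1)%N by lia.
have -> : (4 + (k - 5).+1 - 3)%N = (1 + (k - 5).+1)%N by lia.
by rewrite -!addSn !sgexpD monogenic_rel.
Qed.

Lemma finite_Rees_index_T1 : finite_Rees_index T1.
Proof.
apply: (sub_finite_set _ (finite_image S1_F finite_F)).
by move=> [[x|x]|] //= _; exists x.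
Qed.

Lemma finite_T1_minus_T :
  finite_set [set x : S1 | x \in T1 /\ x \notin T]%classic.
Proof.
by apply: (sub_finite_set _ (finite_set1 (1 : S1))) => -[[x|x]|] //= [].
Qed.

(** On [F] the value [1] is only a default: the map is used on [T1]. *)
Definition collapse (u : S1) : S1 :=
  if u is Some (inr (i.+1, x)) then S1_T (i, x) else 1.

Lemma collapse_T1 u : u \in T1 -> collapse u \in T1.
Proof. by case: u => [[x|[[|i] x]]|]. Qed.

(** The component of index [0] acts as an identity on all the others, so sending it to [1] respects
    products. *)
Lemma collapseM : {in T1 &, {morph collapse : u v / u * v}}.
Proof.
move=> [[x|[i x]]|] [[y|[j y]]|] // _ _; last exact: esym (mulg1 _).
rewrite -![Some _]/(S1_T _) -S1_TM.
case: (ltngtP i j) => [ij|ji|<-].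
- rewrite chain_lt //; case: j ij => [//|j]; case: i => [//|i] ij.
  by rewrite -S1_TM chain_lt.
- rewrite chain_gt //; case: i ji => [//|i]; case: j => [//|j] ij.
  by rewrite -S1_TM chain_gt.
- by rewrite chain_eq; case: i => [//|i]; rewrite -S1_TM chain_eq.
Qed.

Lemma not_hopfian_T1 : ~ hopfian (subsemigroup T1).
Proof.
pose f (u : subsemigroup T1) : subsemigroup T1 :=
  Subsemigroup (collapse_T1 (valP u)).
have fM : {morph f : u v / u * v}.
  move=> u v; apply: val_inj; rewrite [RHS]gmulfM.
  by rewrite -[RHS](collapseM (valP u) (valP v)).
pose fB := isMultiplicative.Build _ _ f fM.
pose fm : {multiplicative subsemigroup T1 -> subsemigroup T1} := HB.pack f fB.
move=> /(_ fm)[].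
  case=> u uT1; case: u uT1 => [[x|[i x]]|] // uT1.
    have vT1 : S1_T (i.+1, x) \in T1 by [].
    by exists (Subsemigroup vT1); apply: val_inj.
  by exists (Subsemigroup uT1); apply: val_inj.
move=> g fK _.
have uT1 : 1 \in T1 by [].
have vT1 : S1_T (0, gen 2 4) \in T1 by [].
(* The identity and the generator of index [0] both go to [1]. *)
have /(can_inj fK) : fm (Subsemigroup uT1) = fm (Subsemigroup vT1).
  exact: val_inj.
by move/(congr1 val).
Qed.

(** The failing extension has [T1] as ambient semigroup, so [T] is needed as a subsemigroup of [T1]
    and not only of [S1]. *)
Definition in_T_of_T1 : pred (subsemigroup T1) := fun u => val u \in T.

Fact in_T_of_T1_closed : mulg_closed in_T_of_T1.
Proof.
by move=> u v; exact: in_T_closed.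
Qed.

HB.instance Definition _ :=
  isMulClosed.Build (subsemigroup T1) in_T_of_T1 in_T_of_T1_closed.

Definition T_of_T1 : mulgClosed (subsemigroup T1) :=
  MulClosed.clone (subsemigroup T1) in_T_of_T1 _.

Lemma hopfian_T_of_T1 : hopfian (subsemigroup T_of_T1).
Proof.
have xT1 x : S1_T x \in T1 by [].
pose h x : subsemigroup T1 := Subsemigroup (xT1 x).
apply: (@hopfian_range Tsg _ T_of_T1 h) hopfian_Tsg.
- by move=> x y /(congr1 val)/S1_T_inj.
- by move=> x y; apply: val_inj; rewrite [RHS]gmulfM.
move=> u; split=> [/in_TP[x xu]|[x <- //]].
by exists x; apply: val_inj.
Qed.

Lemma finite_Rees_index_T_of_T1 : finite_Rees_index T_of_T1.
Proof.
have T1_1 : 1 \in T1 by [].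
apply: (sub_finite_set _ (finite_set1 (Subsemigroup T1_1))).
by move=> [[[x|x]|] xT1] //= _; apply: val_inj.
Qed.

Theorem proposition2p1 :
  [/\ {subset T <= T1},
      finite_set [set x : S1 | x \in T1 /\ x \notin T]%classic
    & finite_Rees_index T1] /\
  [/\ hopfian S1, hopfian (subsemigroup T) & ~ hopfian (subsemigroup T1)] /\
  ~ (forall (U : semigroupType) (V : mulgClosed U),
       finite_Rees_index V -> hopfian (subsemigroup V) -> hopfian U) /\
  ~ (forall (U : semigroupType) (V : mulgClosed U),
       finite_Rees_index V -> hopfian U -> hopfian (subsemigroup V)).
Proof.
split; first by split; [exact: T_sub_T1 | exact: finite_T1_minus_T
                       | exact: finite_Rees_index_T1].
split; first by split; [exact: hopfian_S1 | exact: hopfian_T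
                       | exact: not_hopfian_T1].
split=> [ext|sub].
  apply: not_hopfian_T1.
  exact: ext finite_Rees_index_T_of_T1 hopfian_T_of_T1.
exact: not_hopfian_T1 (sub _ _ finite_Rees_index_T1 hopfian_S1).
Qed.
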